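(* Let $(X,d)$ be a metric space, and let $(X,M,* )$ be the corresponding standard fuzzy metric space. Then \[\operatorname{asdim}(X,d)=\operatorname{asdim}(X,M,* ).\]
   Context: A continuous $t$-norm is a binary operation $*:[0,1]\times[0,1]\to[0,1]$ that is associative, commutative and continuous, satisfies $a*1=a$ for all $a\in[0,1]$, and satisfies $a*b\leq c*d$ whenever $a\leq c$ and $b\leq d$. A fuzzy metric space (in the sense of George and Veeramani) is a triple $(X,M,* )$ where $X$ is a set, $*$ is a continuous $t$-norm, and $M:X\times X\times(0,\infty)\to[0,1]$ satisfies for all $x,y,z\in X$ and all $s,t>0$: (1) $M(x,y,t)>0$; (2) $M(x,y,t)=1$ if and only if $x=y$; (3) $M(x,y,t)=M(y,x,t)$; (4) $M(x,y,t)*M(y,z,s)\leq M(x,z,t+s)$; (5) $M(x,y,\cdot)$ is continuous on $(0,\infty)$. The standard fuzzy metric space corresponding to (induced by) a metric space $(X,d)$ is $(X,M,* )$ with $a*b=ab$ and $M(x,y,t)=\frac{t}{t+d(x,y)}$; it is a fuzzy metric space. Metric notions. A family $\mathcal{U}$ of subsets of $(X,d)$ is uniformly bounded if there exists $t>0$ such that $d(x,y)<t$ for all $x,y\in U$ and all $U\in\mathcal{U}$. Two subsets $U,U'$ are $t$-disjoint ($t>0$) if $d(U,U')>t$, where $d(U,U')=\inf\{d(x,y)\mid x\in U,\,y\in U'\}$ (with $\inf\emptyset=+\infty$); a family is $t$-disjoint if any two distinct elements of it are. For an integer $n\geq 0$, $\operatorname{asdim}(X,d)\leq n$ means: for every $r>0$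 there exist $r$-disjoint families $\mathcal{U}^0,\dots,\mathcal{U}^n$ of subsets of $X$ such that $\bigcup_i\mathcal{U}^i$ is a uniformly bounded cover of $X$. Fuzzy notions. A family $\mathcal{U}$ of subsets of $(X,M,* )$ is uniformly bounded if there exist $r\in(0,1)$ and $t>0$ such that $M(x,y,t)>1-r$ for all $x,y\in U$ and all $U\in\mathcal{U}$. Two subsets $U,U'$ are $(r,t)$-disjoint ($r\in(0,1)$, $t>0$) if $M(U,U',t)<1-r$, where $M(U,U',t)=\sup\{M(x,y,t)\mid x\in U,\,y\in U'\}$ (with $\sup\emptyset=0$); a family is $(r,t)$-disjoint if any two distinct elements of it are. For an integer $n\geq0$, $\operatorname{asdim}(X,M,* )\leq n$ means: for every $r\in(0,1)$ and $t>0$ there exist $(r,t)$-disjoint families $\mathcal{U}^0,\dots,\mathcal{U}^n$ of subsets of $X$ such that $\bigcup_i\mathcal{U}^i$ is a uniformly bounded cover of $X$. In both settings $\operatorname{asdim}$ is the least integer $n\geq 0$ for which $\operatorname{asdim}\leq n$ holds, and $\infty$ if no such $n$ exists. *)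

(* Defs.v *)
From mathcomp Require Import all_boot all_order all_algebra.
From mathcomp Require Import all_classical all_reals ereal topology normedtype.
From mathcomp Require Import ring lra.
Import Order.TTheory GRing.Theory Num.Theory.
Import numFieldNormedType.Exports.

Set Implicit Arguments.
Unset Strict Implicit.
Unset Printing Implicit Defensive.

Local Open Scope classical_set_scope.
Local Open Scope ring_scope.

(* A binary operation on [0, 1] is represented by a function on R stable on
   [0, 1]; its values outside [0, 1] are irrelevant, all axioms being
   restricted to [0, 1]. *)
Record continuousTnorm (R : realType) := ContinuousTnorm {
  tnorm_op :> R -> R -> R ;
  tnorm_itv : forall a b, a \in `[0, 1] -> b \in `[0, 1] ->
    tnorm_op a b \in `[0, 1] ;
  tnormA : forall a b c, a \in `[0, 1] -> b \in `[0, 1] -> c \in `[0, 1] ->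
    tnorm_op a (tnorm_op b c) = tnorm_op (tnorm_op a b) c ;
  tnormC : forall a b, a \in `[0, 1] -> b \in `[0, 1] ->
    tnorm_op a b = tnorm_op b a ;
  tnorm_continuous : {within `[0, 1] `*` `[0, 1],
    continuous (fun p : R * R => tnorm_op p.1 p.2)} ;
  tnorm1 : forall a, a \in `[0, 1] -> tnorm_op a 1 = a ;
  tnorm_le : forall a b c d, a \in `[0, 1] -> b \in `[0, 1] ->
    c \in `[0, 1] -> d \in `[0, 1] -> a <= c -> b <= d ->
    tnorm_op a b <= tnorm_op c d }.

(* Fuzzy metrics in the sense of George and Veeramani; the values of [fdist] at
   nonpositive parameters are irrelevant. *)
Record fuzzyMetric (R : realType) (X : Type) := FuzzyMetric {
  ftnorm : continuousTnorm R ;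
  fdist :> X -> X -> R -> R ;
  fdist_itv : forall x y t, 0 < t -> fdist x y t \in `[0, 1] ;
  fdist_gt0 : forall x y t, 0 < t -> 0 < fdist x y t ;
  fdist_eq1 : forall x y t, 0 < t -> (fdist x y t = 1 <-> x = y) ;
  fdist_sym : forall x y t, 0 < t -> fdist x y t = fdist y x t ;
  fdist_triangle : forall x y z t s, 0 < t -> 0 < s ->
    ftnorm (fdist x y t) (fdist y z s) <= fdist x z (t + s) ;
  fdist_continuous : forall x y, {within `]0, +oo[, continuous (fdist x y)} }.

Section standard_fuzzy_metric.
Variable R : realType.

Lemma product_itv (a b : R) :
  a \in `[0, 1] -> b \in `[0, 1] -> a * b \in `[0, 1].
Proof.
rewrite !in_itv/= => /andP[a0 a1] /andP[b0 b1].
by rewrite mulr_ge0//= mulr_ile1.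
Qed.

Lemma product_continuous :
  {within `[0, 1] `*` `[0, 1], continuous (fun p : R * R => p.1 * p.2)}.
Proof.
apply: continuous_subspaceT => p.
by apply: cvgM; [exact: cvg_fst|exact: cvg_snd].
Qed.

Lemma product_le (a b c d : R) : a \in `[0, 1] -> b \in `[0, 1] ->
  c \in `[0, 1] -> d \in `[0, 1] -> a <= c -> b <= d -> a * b <= c * d.
Proof.
rewrite !in_itv/= => /andP[a0 _] /andP[b0 _] _ _ ac bd.
exact: ler_pM.
Qed.

Definition product_tnorm : continuousTnorm R :=
  @ContinuousTnorm R *%R product_itv (fun a b c _ _ _ => mulrA a b c)
    (fun a b _ _ => mulrC a b) product_continuous (fun a _ => mulr1 a)
    product_le.

Variable X : metricType R.

Definition standard_fdist (x y : X) (t : R) : R := t / (t + mdist x y).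

Let den_gt0 (x y : X) (t : R) : 0 < t -> 0 < t + mdist x y.
Proof. by move=> t0; rewrite ltr_wpDr// mdist_ge0. Qed.

Lemma standard_fdist_gt0 x y t : 0 < t -> 0 < standard_fdist x y t.
Proof. by move=> t0; rewrite divr_gt0// den_gt0. Qed.

Lemma standard_fdist_itv x y t : 0 < t -> standard_fdist x y t \in `[0, 1].
Proof.
move=> t0; rewrite in_itv/= ltW ?standard_fdist_gt0//=.
by rewrite ler_pdivrMr ?den_gt0// mul1r lerDl mdist_ge0.
Qed.

Lemma standard_fdist_eq1 x y t : 0 < t ->
  (standard_fdist x y t = 1 <-> x = y).
Proof.
move=> t0; rewrite /standard_fdist; split => [|->]; last first.
  by rewrite mdistxx addr0 divff// gt_eqF.
move/(congr1 ( *%R^~ (t + mdist x y))).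
rewrite divfK ?gt_eqF ?den_gt0// mul1r => e.
by apply: mdist_positivity; lra.
Qed.

Lemma standard_fdist_sym x y t : 0 < t ->
  standard_fdist x y t = standard_fdist y x t.
Proof. by rewrite /standard_fdist metric_sym. Qed.

Lemma standard_fdist_triangle x y z t s : 0 < t -> 0 < s ->
  product_tnorm (standard_fdist x y t) (standard_fdist y z s) <=
  standard_fdist x z (t + s).
Proof.
move=> t0 s0; rewrite /= /standard_fdist mulf_div.
have ts0 : 0 < t + s by rewrite addr_gt0.
rewrite ler_pdivrMr ?mulr_gt0 ?den_gt0// mulrAC ler_pdivlMr ?den_gt0//.
have := metric_triangle x y z.
have := mdist_ge0 x y; have := mdist_ge0 y z.
move: (mdist x y) (mdist y z) (mdist x z) => a b c b0 a0 cab.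
have tsc : t * s * (t + s + c) <= t * s * (t + s + (a + b)).
  by rewrite ler_pM2l ?mulr_gt0// lerD2l.
apply: (le_trans tsc); rewrite -subr_ge0.
rewrite [X in 0 <= X](_ : _ = t ^+ 2 * b + s ^+ 2 * a + a * b * (t + s));
  last by ring.
by rewrite !addr_ge0// ?mulr_ge0// ?sqr_ge0// ?ltW.
Qed.

Lemma standard_fdist_continuous x y :
  {within `]0, +oo[, continuous (standard_fdist x y)}.
Proof.
apply: continuous_in_subspaceT => t; rewrite inE/= in_itv/= andbT => t0.
apply: cvgM; first exact: cvg_id.
apply: cvgV; first by rewrite gt_eqF// den_gt0.
by apply: cvgD; [exact: cvg_id|exact: cvg_cst].
Qed.

Definition standard_fuzzy_metric : fuzzyMetric R X :=
  @FuzzyMetric R X product_tnorm standard_fdist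
    standard_fdist_itv standard_fdist_gt0 standard_fdist_eq1
    standard_fdist_sym standard_fdist_triangle standard_fdist_continuous.

End standard_fuzzy_metric.

(* The least n such that P n holds, and +oo if there is none; -oo is never
   taken. *)
Definition least_nat (P : nat -> Prop) : \bar nat :=
  match pselect (exists n, `[< P n >]) with
  | left exP => EFin (ex_minn exP)
  | right _ => +oo%E
  end.

Section metric_asdim.
Variables (R : realType) (X : metricType R).

Definition unif_bounded (F : set (set X)) : Prop :=
  exists2 t : R, 0 < t &
    forall U, F U -> forall x y, U x -> U y -> mdist x y < t.

Definition set_dist (U V : set X) : \bar R :=
  ereal_inf [set (mdist x y)%:E | x in U & y in V].

Definition disjoint_family (t : R) (F : set (set X)) : Prop :=
  forall U V, F U -> F V -> U <> V -> (t%:E < set_dist U V)%E.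

Definition asdim_le (n : nat) : Prop :=
  forall r : R, 0 < r -> exists U : 'I_n.+1 -> set (set X),
    [/\ forall i, disjoint_family r (U i),
        unif_bounded (\bigcup_i U i) &
        \bigcup_(A in \bigcup_i U i) A = setT].

Definition asdim : \bar nat := least_nat asdim_le.

End metric_asdim.

Section fuzzy_asdim.
Variables (R : realType) (X : Type) (M : fuzzyMetric R X).

Definition fuzzy_unif_bounded (F : set (set X)) : Prop :=
  exists r t : R, [/\ 0 < r < 1, 0 < t &
    forall U, F U -> forall x y, U x -> U y -> 1 - r < M x y t].

(* For t > 0 the set below is bounded by 1, and [sup set0 = 0] (lemma [sup0]),
   so the real-valued [sup] follows the convention on empty sets. *)
Definition fuzzy_set_dist (U V : set X) (t : R) : R :=
  sup [set M x y t | x in U & y in V].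

Definition fuzzy_disjoint_family (r t : R) (F : set (set X)) : Prop :=
  forall U V, F U -> F V -> U <> V -> fuzzy_set_dist U V t < 1 - r.

Definition fuzzy_asdim_le (n : nat) : Prop :=
  forall r t : R, 0 < r < 1 -> 0 < t ->
  exists U : 'I_n.+1 -> set (set X),
    [/\ forall i, fuzzy_disjoint_family r t (U i),
        fuzzy_unif_bounded (\bigcup_i U i) &
        \bigcup_(A in \bigcup_i U i) A = setT].

Definition fuzzy_asdim : \bar nat := least_nat fuzzy_asdim_le.

End fuzzy_asdim.

Arguments asdim {R} X.

(* Main.v *)
(** For fixed [t > 0] the map [s |-> t / (t + s)] is a decreasing bijection
from [[0, +oo[] onto []0, 1]], so bounds on the distance and bounds on the
standard fuzzy metric translate into each other. Strict inequalities may be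
lost when passing to an infimum or a supremum; this is harmless because the
disjointness parameters are arbitrary and can be chosen with some slack. *)
Require Import Defs.
From mathcomp Require Import all_boot all_order all_algebra.
From mathcomp Require Import all_classical all_reals ereal topology normedtype.
From mathcomp Require Import ring lra.
Import Order.TTheory GRing.Theory Num.Theory.

Set Implicit Arguments.
Unset Strict Implicit.
Unset Printing Implicit Defensive.

Local Open Scope classical_set_scope.
Local Open Scope ring_scope.

Lemma eq_least_nat (P Q : nat -> Prop) :
  (forall n, P n <-> Q n) -> least_nat P = least_nat Q.
Proof. by move=> PQ; congr least_nat; apply/funext => n; apply/propext. Qed.

Section standard_asdim.
Variables (R : realType) (X : metricType R).
Implicit Types (x y : X) (r s t : R) (F : set (set X)).

(** Both denominators are positive, so the two fractions compare in reverse order of [s] and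
    [mdist x y]. *)
Lemma standard_fdist_le x y s t : 0 < t -> 0 <= s ->
  (standard_fdist x y t <= t / (t + s)) = (s <= mdist x y).
Proof.
move=> t0 s0; have d0 := mdist_ge0 x y.
by rewrite /standard_fdist ler_pM2l// lef_pV2 ?lerD2l ?posrE ?ltr_wpDr.
Qed.

Lemma standard_fdist_gt x y s t : 0 < t -> 0 <= s ->
  (t / (t + s) < standard_fdist x y t) = (mdist x y < s).
Proof. by move=> t0 s0; rewrite !ltNge standard_fdist_le. Qed.

(** For [s = t / (1 - r)] the value [t / (t + s)] is [(1 - r) / (2 - r)], strictly below [1 - r], so
    the bound stays strict for the supremum. *)
Lemma disjoint_family_standard r t F : 0 < r < 1 -> 0 < t ->
  disjoint_family (t / (1 - r)) F ->
  fuzzy_disjoint_family (standard_fuzzy_metric X) r t F.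
Proof.
move=> /andP[r0 r1] t0 disjF U V FU FV UV.
have s0 : 0 < t / (1 - r) by rewrite divr_gt0// subr_gt0.
have := disjF _ _ FU FV UV; set s := t / (1 - r) in s0 * => sUV.
have lt1r : t / (t + s) < 1 - r.
  rewrite ltr_pdivrMr ?addr_gt0// mulrDr [(1 - r) * s]mulrC.
  by rewrite divfK ?gt_eqF ?subr_gt0// ltrDr mulr_gt0// subr_gt0.
rewrite /fuzzy_set_dist; set S := [set _ | _ in _ & _ in _].
have [->|S0] := eqVneq S set0; first by rewrite sup0 subr_gt0.
apply: le_lt_trans lt1r; apply: ge_sup; first exact/set0P.
move=> _ [x Ux [y Vy <-]]; rewrite standard_fdist_le ?ltW// -lte_fin.
by apply: lt_le_trans sUV _; apply: ereal_inf_lbound; exists x => //; exists y.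
Qed.

Lemma standard_disjoint_family s F : 0 < s ->
  fuzzy_disjoint_family (standard_fuzzy_metric X) (2 / 3) s F ->
  disjoint_family s F.
Proof.
move=> s0 disjF U V FU FV UV.
(* The parameter [2 / 3] forces distances of at least [2 s], since [s / (s + 2 s) = 1 / 3]; the
   infimum then exceeds [s], also when it is [+oo]. *)
apply: (@lt_le_trans _ _ (s + s)%:E); first by rewrite lte_fin ltrDl.
apply/ereal_infP => _ [x Ux [y Vy <-]].
rewrite lee_fin -(@standard_fdist_le _ _ _ s)// ?addr_ge0 ?ltW//.
have -> : s / (s + (s + s)) = 1 - 2 / 3 by field; rewrite gt_eqF//; lra.
apply: le_lt_trans (disjF _ _ FU FV UV); apply: ub_le_sup; last first.
  by exists x => //; exists y.
(* A real [sup] dominates its set only if the set is bounded above; here 1 is a bound. *)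
exists 1 => _ [a _ [b _ <-]].
by have := standard_fdist_itv a b s0; rewrite in_itv/= => /andP[].
Qed.

Lemma standard_unif_bounded F :
  fuzzy_unif_bounded (standard_fuzzy_metric X) F <-> unif_bounded F.
Proof.
split=> [[r [t [/andP[r0 r1] t0 bF]]]|[t t0 bF]].
  have s0 : 0 < t * r / (1 - r) by rewrite !divr_gt0 ?mulr_gt0// subr_gt0.
  (* This is the solution [s] of [t / (t + s) = 1 - r]. *)
  exists (t * r / (1 - r)) => // U FU x y Ux Uy.
  rewrite -(@standard_fdist_gt _ _ _ t) ?ltW//.
  suff -> : t / (t + t * r / (1 - r)) = 1 - r by exact: bF FU _ _ Ux Uy.
  by field; rewrite !gt_eqF//; lra.
(* At distance [t] the fuzzy metric at parameter [t] equals [1 / 2]. *)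
exists (1 / 2), t; split => // [|U FU x y Ux Uy]; first by lra.
have -> : 1 - 1 / 2 = t / (t + t) by field; rewrite gt_eqF//; lra.
by rewrite standard_fdist_gt ?ltW//; exact: bF FU _ _ Ux Uy.
Qed.

Lemma standard_asdim_le n :
  asdim_le X n <-> fuzzy_asdim_le (standard_fuzzy_metric X) n.
Proof.
split=> [leX r t r01 t0|leX r r0].
  have /leX[U [disjU bU coverU]] : 0 < t / (1 - r) by rewrite divr_gt0//; lra.
  exists U; split=> // [i|]; last exact/standard_unif_bounded.
  exact: disjoint_family_standard.
have [|U [disjU bU coverU]] := leX (2 / 3) r _ r0; first by lra.
exists U; split=> // [i|]; last exact/standard_unif_bounded.
exact: standard_disjoint_family.
Qed.

End standard_asdim.

Theorem proposition3p9 (R : realType) (X : metricType R) :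
  asdim X = fuzzy_asdim (standard_fuzzy_metric X).
Proof. by apply: eq_least_nat => n; exact: standard_asdim_le. Qed.
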